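(* Consider the billiard in a square table $M=[0,L]\times[0,L]$, $L>0$. Then for every point $P\in M$ the billiard wave front $W_t(P)$ becomes dense on $M$. That is, for every $P\in M$ and every $r>0$ there is a time $\tau(P,r)$ such that for all $t>\tau(P,r)$ and all $Q\in M$ the set $W_t(P)$ contains a point at Euclidean distance less than $r$ from $Q$.
   Context: In the billiard in $M=[0,L]^2$ a point particle moves with unit speed along straight lines in the interior and is reflected at the sides according to the law that the angle of incidence equals the angle of reflection. The wave front $W_t(P)$ is the set of positions at time $t$ of the billiard trajectories that start at $P$ at time $0$, over all initial unit directions. Explicitly, by unfolding the table, $W_t(P)=\pi(S_t(P))$, where $S_t(P)\subset\mathbb{R}^2$ is the Euclidean circle of radius $t$ centered at $P\in[0,L]^2\subset\mathbb{R}^2$ and $\pi:\mathbb{R}^2\to[0,L]^2$ is the folding map $\pi(x,y)=(q(x),q(y))$, with $q:\mathbb{R}\to[0,L]$ the $2L$-periodic function given by $q(x)=x$ for $x\in[0,L]$ and $q(x)=2L-x$ for $x\in[L,2L]$. (This formula also fixes the convention for trajectories that run into a corner of the square.) The wave front $W_t(P)$ is said to become dense on $M$ if for every open ball $B_r(Q)$ in $M$ with $r>0$ there is a time $\tau(P,r)$ (depending on $P$ and $r$ but not on $Q$) such that $W_t(P)\cap B_r(Q)\neq\emptyset$ for all $t>\tau(P,r)$. *)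

(* Defs.v *)
From HB Require Import structures.
From mathcomp Require Import all_boot all_order all_algebra.
From mathcomp Require Import archimedean ring lra.
From mathcomp Require Import classical_sets reals.

Set Implicit Arguments.
Unset Strict Implicit.
Unset Printing Implicit Defensive.
Import Order.TTheory GRing.Theory Num.Theory.
Local Open Scope classical_set_scope.
Local Open Scope ring_scope.

(* The product type R * R carries the sup norm in MathComp-Analysis, whence an
   explicit Euclidean distance. *)
Definition eucl_dist (R : realType) (A B : R * R) : R :=
  Num.sqrt ((A.1 - B.1) ^+ 2 + (A.2 - B.2) ^+ 2).

Definition square (R : realType) (L : R) : set (R * R) :=
  [set A | 0 <= A.1 <= L /\ 0 <= A.2 <= L].

Definition circle (R : realType) (t : R) (P : R * R) : set (R * R) :=
  [set A | eucl_dist A P = t].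

(* The 2L-periodic folding R -> [0, L], computed on the representative of x
   modulo 2L in [0, 2L[; fold1_periodic, fold1_id and fold1_refl
   characterize it. *)
Definition fold1 (R : realType) (L x : R) : R :=
  let y := x - (2 * L) * (Num.floor (x / (2 * L)))%:~R in
  if y <= L then y else 2 * L - y.

Definition fold2 (R : realType) (L : R) (A : R * R) : R * R :=
  (fold1 L A.1, fold1 L A.2).

Definition wave_front (R : realType) (L : R) (P : R * R) (t : R) :
    set (R * R) :=
  fold2 L @` circle t P.

Definition ball_in (R : realType) (M : set (R * R)) (Q : R * R) (r : R) :
    set (R * R) :=
  [set A | M A /\ eucl_dist A Q < r].

(* The time tau is uniform in the centre Q of the ball. *)
Definition becomes_dense (R : realType) (M : set (R * R))
    (W : R -> set (R * R)) : Prop :=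
  forall r : R, 0 < r ->
  exists tau : R, forall t : R, tau < t ->
  forall Q : R * R, M Q -> W t `&` ball_in M Q r !=set0.

Lemma fold1_periodic (R : realType) (L x : R) :
  0 < L -> fold1 L (x + 2 * L) = fold1 L x.
Proof.
move=> L0; rewrite /fold1.
have -> : (x + 2 * L) / (2 * L) = x / (2 * L) + 1 by field; lra.
rewrite floorDrz ?rpred1// floor1 intrD.
by have -> : x + 2 * L - 2 * L * ((Num.floor (x / (2 * L)))%:~R + 1) =
  x - 2 * L * (Num.floor (x / (2 * L)))%:~R by ring.
Qed.

Lemma fold1_id (R : realType) (L x : R) :
  0 < L -> 0 <= x <= L -> fold1 L x = x.
Proof.
move=> L0 /andP[x0 xL]; rewrite /fold1.
have -> : Num.floor (x / (2 * L)) = 0.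
  by apply: floor_def; rewrite add0r divr_ge0 ?ltr_pdivrMr /=; lra.
by rewrite mulr0 subr0 xL.
Qed.

Lemma fold1_refl (R : realType) (L x : R) :
  0 < L -> L <= x <= 2 * L -> fold1 L x = 2 * L - x.
Proof.
move=> L0 /andP[Lx]; rewrite le_eqVlt => /orP[/eqP ->|x2L].
  by rewrite subrr -[2 * L]add0r fold1_periodic// fold1_id// lexx ltW.
rewrite /fold1.
have -> : Num.floor (x / (2 * L)) = 0.
  by apply: floor_def; rewrite add0r divr_ge0 ?ltr_pdivrMr /=; lra.
rewrite mulr0 subr0; case: ifP => // xL; lra.
Qed.

(* Main.v *)
Require Import Defs.
From mathcomp Require Import all_boot all_order all_algebra.
From mathcomp Require Import archimedean ring lra.
From mathcomp Require Import classical_sets reals.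
Import Order.TTheory GRing.Theory Num.Theory.
Local Open Scope classical_set_scope.
Local Open Scope ring_scope.

(** Near its top the circle of radius [t] is almost flat. On the vertical lines
    over the translates [Q.1 + 2 L k], the heights of its points decrease with
    [k >= 0] in steps smaller than [r] as long as the horizontal distance to
    the centre is at most [c t], with [c] proportional to [r / L]. The total
    descent over that range is of order [c^2 t], which exceeds the period [2 L]
    for large [t], so some height is within [r] of [Q.2] modulo [2 L]. *)

Lemma fold1_shift (R : realType) (L x : R) (m : int) :
  0 < L -> fold1 L (x + 2 * L * m%:~R) = fold1 L x.
Proof.
move=> L0; rewrite /fold1.
have -> : (x + 2 * L * m%:~R) / (2 * L) = x / (2 * L) + m%:~R.
  by field; rewrite gt_eqF.
rewrite floorDrz ?intr_int// intrKfloor intrD.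
by have -> : x + 2 * L * m%:~R
    - 2 * L * ((Num.floor (x / (2 * L)))%:~R + m%:~R) =
  x - 2 * L * (Num.floor (x / (2 * L)))%:~R by ring.
Qed.

(** Since [x + d] lies in [0, 2L], it is reflected at most once, at [L]. *)
Lemma fold1_near (R : realType) (L x d : R) :
  0 < L -> 0 <= x <= L -> 0 <= d <= L ->
  0 <= fold1 L (x + d) <= L /\ `|fold1 L (x + d) - x| <= d.
Proof.
move=> L0 /andP[x0 xL] /andP[d0 dL]; rewrite ler_norml.
have [xdL|Lxd] := leP (x + d) L.
  by rewrite fold1_id//; [split; apply/andP; split; lra | apply/andP; split; lra].
by rewrite fold1_refl//; [split; apply/andP; split; lra | apply/andP; split; lra].
Qed.

Lemma discrete_crossing (R : realType) (f : nat -> R) (E : R) (N : nat) :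
  E <= f 0%N -> f N < E -> exists k, [/\ (k < N)%N, E <= f k & f k.+1 < E].
Proof.
move=> f0; elim: N => [|N IH] fN; first by move: fN; rewrite ltNge f0.
have [EfN|/IH[k [kN Ek Ek1]]] := leP E (f N); first by exists N.
by exists k; split=> //; apply: ltnW.
Qed.

(** Here [(d, e)] is the offset from the centre to the target; [L <= d] puts every line with
    [k >= 0] to the right of the centre, so heights fall from the first one on. *)
Lemma circle_height_near (R : realType) (L r d e t : R) :
  0 < L -> 0 < r <= L -> L <= d <= 3 * L ->
  32 * L / (r / (8 * L)) ^+ 2 < t ->
  exists (k m : int) (h : R), 0 <= h < r /\
    (d + 2 * L * k%:~R) ^+ 2 + (e + 2 * L * m%:~R + h) ^+ 2 = t ^+ 2.
Proof.
move=> L0 /andP[r0 rL] /andP[Ld d3L].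
(* With this [c], one step of [2 * L] within distance [c * t] lowers the height by at most
   [4 * L * c = r / 2]. *)
set c := r / (8 * L).
have rE : r = 8 * L * c by rewrite /c; field; rewrite gt_eqF.
have c0 : 0 < c by rewrite divr_gt0// mulr_gt0.
have c8 : 8 * c <= 1 by rewrite -(ler_pM2l L0); lra.
rewrite ltr_pdivrMr ?exprn_gt0// => tc.
have c2 : c ^+ 2 <= c / 8 by nra.
have t0 : 0 < t by rewrite -(pmulr_lgt0 _ (exprn_gt0 2 c0)); lra.
have tcL : 256 * L <= t * c by nra.
have tL : 2048 * L <= t by nra.
pose x (k : nat) := d + 2 * L * k%:R.
pose f k := Num.sqrt (t ^+ 2 - x k ^+ 2).
(* The last index whose line is within [c * t] of the centre. *)
pose n := Num.floor ((c * t - d) / (2 * L)).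
have L2 : 0 < 2 * L by rewrite mulr_gt0.
have n0 : 0 <= n by rewrite floor_ge0 divr_ge0 ?(ltW L2)//; lra.
pose N := `|n|%N.
have nE : n%:~R = N%:R :> R by rewrite /N -[in LHS](gez0_abs n0).
have xN : x N <= c * t.
  have := floor_le ((c * t - d) / (2 * L)).
  by rewrite -/n nE ler_pdivlMr// /x; lra.
have xN' : c * t - 2 * L < x N.
  have := floorD1_gt ((c * t - d) / (2 * L)).
  by rewrite -/n intrD nE ltr_pdivrMr// /x; lra.
have xk k : (k <= N)%N -> 0 <= x k <= c * t.
  move=> kN; have kNr : k%:R <= N%:R :> R by rewrite ler_nat.
  have k0 : 0 <= k%:R :> R by [].
  by apply/andP; split; [rewrite /x; nra | move: xN; rewrite /x; nra].
have rad k : (k <= N)%N -> (t / 2) ^+ 2 <= t ^+ 2 - x k ^+ 2.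
  move=> /xk /andP[x0 xct]; have xt : x k <= t / 8 by nra.
  by nra.
have f2 k : (k <= N)%N -> f k ^+ 2 = t ^+ 2 - x k ^+ 2.
  by move=> /rad kN; rewrite sqr_sqrtr// (le_trans _ kN)// sqr_ge0.
have ft k : (k <= N)%N -> t / 2 <= f k <= t.
  move=> kN; have f0 : 0 <= f k := sqrtr_ge0 _.
  have := rad _ kN; rewrite -f2// => tf.
  have fkt : f k ^+ 2 <= t ^+ 2 by rewrite f2// lerBlDr lerDl sqr_ge0.
  apply/andP; split.
    by rewrite -(@ler_pXn2r _ 2)// ?nnegrE// divr_ge0// ltW.
  by rewrite -(@ler_pXn2r _ 2)// ?nnegrE// ltW.
(* [E] is the highest translate of [e] not above [f 0]. *)
pose m := Num.floor ((f 0%N - e) / (2 * L)).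
pose E := e + 2 * L * m%:~R.
have E0 : E <= f 0%N.
  have := floor_le ((f 0%N - e) / (2 * L)).
  by rewrite -/m ler_pdivlMr// /E; lra.
have E0' : f 0%N < E + 2 * L.
  have := floorD1_gt ((f 0%N - e) / (2 * L)).
  by rewrite -/m intrD ltr_pdivrMr// /E; lra.
(* Otherwise [f 0 - f N < 2 * L], so the squares of these heights differ by at most [4 * L * t]; but
   they differ by [x N ^+ 2 - x 0 ^+ 2], at least [8 * L * t - 9 * L ^+ 2]. *)
have EN : f N < E.
  rewrite ltNge; apply/negP => EfN.
  have := f2 0%N (leq0n _); have := f2 N (leqnn _).
  have /andP[? f0t] := ft 0%N (leq0n _).
  have /andP[? fNt] := ft N (leqnn _).
  have x0 : x 0%N ^+ 2 <= 9 * L ^+ 2 by rewrite /x mulr0 addr0; nra.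
  have xN2 : (c * t / 2) ^+ 2 <= x N ^+ 2.
    by rewrite ler_pXn2r ?nnegrE//; nra.
  have ct2 : 32 * L * t <= (c * t) ^+ 2.
    have -> : (c * t) ^+ 2 = t * c ^+ 2 * t by ring.
    by rewrite ler_pM2r// ltW.
  have LtL : 2048 * L ^+ 2 <= L * t by nra.
  have drop : (f 0%N - f N) * (f 0%N + f N) <= 2 * L * (2 * t).
    by apply: (@le_trans _ _ (2 * L * (f 0%N + f N)));
      rewrite ?ler_pM2r ?ler_pM2l//; lra.
  by move=> fN2 f02; nra.
have [k [kN Ek Ek1]] := @discrete_crossing _ f E N E0 EN.
exists k, m, (f k - E); split; last first.
  rewrite -/E -/(x k) [E + _]addrC subrK f2; first by rewrite addrC subrK.
  exact: ltnW.
(* If [r <= f k - E], then [f k - f k.+1 > r]. As both heights are at least [t / 2], their squares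
   differ by at least [r * t], twice what the horizontal step allows. *)
rewrite subr_ge0 Ek /= ltNge; apply/negP => step.
have := f2 k (ltnW kN); have := f2 k.+1 kN.
have /andP[fk _] := ft k (ltnW kN); have /andP[fk1 _] := ft k.+1 kN.
have /andP[_ xk0] := xk k (ltnW kN); have /andP[_ xk1] := xk k.+1 kN.
have xS : x k.+1 = x k + 2 * L by rewrite /x -natr1; ring.
have drop : r * t <= (f k - f k.+1) * (f k + f k.+1) by apply: ler_pM; lra.
have run : (x k.+1 - x k) * (x k.+1 + x k) <= 2 * L * (2 * (c * t)).
  by rewrite xS addrAC subrr add0r ler_pM2l//; lra.
have rt : r * t = 2 * (2 * L * (2 * (c * t))) by rewrite rE; ring.
have rt0 : 0 < r * t by rewrite mulr_gt0.
by move=> ? ?; nra.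
Qed.

Theorem corollary1 (R : realType) (L : R) (hL : 0 < L) (P : R * R)
    (hP : square L P) :
  becomes_dense (square L) (wave_front L P).
Proof.
(* Capping the radius at [L] keeps [h <= L], as [fold1_near] requires. *)
move=> r r0; pose r' := Num.min r L.
have r'0 : 0 < r' by rewrite lt_min r0.
have r'r : r' <= r by rewrite ge_min lexx.
have r'L : r' <= L by rewrite ge_min lexx orbT.
exists (32 * L / (r' / (8 * L)) ^+ 2) => t tau_t Q [Q1 Q2].
case: hP => P1 P2.
have t0 : 0 <= t.
  by apply: ltW; apply: le_lt_trans tau_t; rewrite divr_ge0 ?sqr_ge0//; lra.
(* [Q.1 - P.1] lies in [-L, L]; adding one period brings it into [L, 3L]. *)
have [k [m [h [/andP[h0 hr] pyth]]]] :=
  @circle_height_near _ L r' (Q.1 - P.1 + 2 * L) (Q.2 - P.2) t hL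
    ltac:(by rewrite r'0) ltac:(by apply/andP; split; lra) tau_t.
have hL' : 0 <= h <= L by apply/andP; split; lra.
have [F01 Fh] := fold1_near _ _ _ _ hL Q2 hL'.
exists (Q.1, fold1 L (Q.2 + h)); split; last first.
  split; first by [].
  rewrite /eucl_dist /= subrr expr0n add0r sqrtr_sqr; lra.
(* The [1] in [1 + k] is the period added to [Q.1 - P.1] above. *)
exists (Q.1 + 2 * L * (1 + k)%:~R, Q.2 + h + 2 * L * m%:~R).
  rewrite /circle /eucl_dist /=.
  rewrite -[RHS](ger0_norm t0) -sqrtr_sqr -pyth; congr Num.sqrt.
  by rewrite intrD; ring.
by rewrite /fold2 /= !fold1_shift// fold1_id.
Qed.
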